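(* Given a regularized MDP (R-MDP) model defined by a tuple $(\mathcal S,\mathcal A,q,r,\gamma)$ and a set of strictly concave functions $\{\phi_s\mid s\in\mathcal S\}$, there exists a set of constants $\{c_s,\ s\in\mathcal S\}$ such that the constrained MDP (CT-MDP) model defined by the same tuple but with the shifted reward function $r'(a|s)=r(a|s)-c_s$ and with feasible sets $\mathcal D^\pi_s=\{\pi_s\in\Delta(|\mathcal A|)\mid -\phi_s(\pi_s)\le c_s\}$, $s\in\mathcal S$, yields an identical optimal policy.
   Context: Setting. $\mathcal S$ is a finite set of states, $\mathcal A$ a finite set of actions, $q(s'|s,a)$ the transition probabilities, $r=(r(a|s))\in\mathbb R^{|\mathcal S|\times|\mathcal A|}$ the reward function, $\gamma\in[0,1)$ the discount factor. $\Delta(|\mathcal A|)$ is the probability simplex in $\mathbb R^{|\mathcal A|}$, a policy is $\pi=(\pi_s)_{s\in\mathcal S}$ with $\pi_s=(\pi(a|s))_a\in\Delta(|\mathcal A|)$, and $\Delta^\pi$ is the set of policies. Trajectories are $\tau=(s_0,a_0,s_1,a_1,\dots)$. R-MDP: with real-valued regularizers $\phi_s$ on $\Delta(|\mathcal A|)$, the problem is $\sup_{\pi^t\in\Delta^\pi,\,t\ge0}\mathbb E_{\tau}[\sum_{t\ge0}\gamma^t(r(a_t|s_t)+\phi_{s_t}(\pi^t_{s_t}))]$; its value function $V$ is the optimal value conditional on $s_0=s$, and an optimal (stationary) policy is $\pi^*_s\in\mathrm{argmax}_{\pi_s\in\Delta(|\mathcal A|)}\{\sum_a\pi(a|s)[r(a|s)+\gamma\sum_{s'}q(s'|s,a)V(s')]+\phi_s(\pi_s)\}$.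 CT-MDP: with a feasible set $\mathcal D^\pi=\otimes_{s\in\mathcal S}\mathcal D^\pi_s$, $\mathcal D^\pi_s\subset\Delta(|\mathcal A|)$ nonempty, and reward $r'$, the problem is $\sup_{\pi^t\in\mathcal D^\pi,\,t\ge0}\mathbb E_\tau[\sum_{t\ge0}\gamma^t r'(a_t|s_t)]$; its value function $V$ is the optimal value conditional on $s_0=s$, and an optimal (stationary) policy is $\pi^*_s\in\mathrm{argmax}_{\pi_s\in\mathcal D^\pi_s}\sum_a\pi(a|s)[r'(a|s)+\gamma\sum_{s'}q(s'|s,a)V(s')]$.
   Formalization: The optimal policies are shown to be identical whenever the regularized MDP has an optimal policy; for discontinuous strictly concave functions the maximum may not be attained, and then there is no optimal policy to compare. *)

(* Defs.v *)
From mathcomp Require Export all_boot all_order all_algebra.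
From mathcomp Require Export all_classical all_reals all_analysis.

Set Implicit Arguments.
Unset Strict Implicit.
Unset Printing Implicit Defensive.

Import Order.TTheory GRing.Theory Num.Theory.
Import numFieldNormedType.Exports.

Local Open Scope classical_set_scope.
Local Open Scope ring_scope.

Definition simplex (R : realType) (T : finType) : set {ffun T -> R} :=
  [set p | (forall x, 0 <= p x) /\ \sum_x p x = 1].
Arguments simplex : clear implicits.

Definition strictly_concave_on (R : realType) (T : finType)
    (D : set {ffun T -> R}) (f : {ffun T -> R} -> R) : Prop :=
  forall (p p' : {ffun T -> R}) (t : R), D p -> D p' -> p <> p' -> 0 < t < 1 ->
    t * f p + (1 - t) * f p' < f [ffun x => t * p x + (1 - t) * p' x].

Definition is_argmax (R : realType) (T : Type) (D : set T) (f : T -> R)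
    (x : T) : Prop :=
  D x /\ forall y, D y -> f y <= f x.

Section MDP.
Variables (R : realType) (S A : finType).

(* [pi s a] is the probability of the action a in the state s. *)
Definition policy : Type := S -> {ffun A -> R}.

(* [q s a s'] is the probability q(s'|s,a), [r s a] the reward r(a|s). *)
Variables (q : S -> A -> {ffun S -> R}) (gamma : R).

(* Probability that a trajectory started at [s0] and controlled by the policies
   [pi t] begins with (h 0, ..., h n), where h t = (s_t, a_t). *)
Definition prefix_prob (pi : nat -> policy) (s0 : S) (n : nat)
    (h : nat -> S * A) : R :=
  ((h 0%N).1 == s0)%:R
  * (\prod_(0 <= t < n.+1) pi t (h t).1 (h t).2)
  * (\prod_(0 <= t < n) q (h t).1 (h t).2 (h t.+1).1).

(* The random sequence [tau] is a trajectory (s_0,a_0,s_1,a_1,...) under [pi]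
   from [s0]. Its law is determined by its finite-dimensional marginals. *)
Definition is_trajectory (pi : nat -> policy) (s0 : S)
    d (Omega : measurableType d) (P : probability Omega R)
    (tau : nat -> Omega -> S * A) : Prop :=
  (forall t x, measurable (tau t @^-1` [set x])) /\
  (forall n h, P [set w | forall t, (t <= n)%N -> tau t w = h t]
               = (prefix_prob pi s0 n h)%:E).

(* [g s a p] is the payoff of a stage in state s where the action a is drawn
   from the distribution p. *)
Definition discounted_payoff (g : S -> A -> {ffun A -> R} -> R)
    (pi : nat -> policy) (tau : nat -> S * A) : R :=
  limn (series (fun t =>
    gamma ^+ t * g (tau t).1 (tau t).2 (pi t (tau t).1))).

(* The expectation depends only on the law of the trajectory, hence not on the
   probability space that carries it. *)
Definition is_expected_payoff (g : S -> A -> {ffun A -> R} -> R)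
    (pi : nat -> policy) (s0 : S) (e : \bar R) : Prop :=
  exists d (Omega : measurableType d) (P : probability Omega R)
         (tau : nat -> Omega -> S * A),
    is_trajectory pi s0 P tau /\
    e = ('E_P[fun w => discounted_payoff g pi (fun t => tau t w)])%E.

Definition value (D : S -> set {ffun A -> R})
    (g : S -> A -> {ffun A -> R} -> R) (s : S) : \bar R :=
  ereal_sup [set e | exists pi : nat -> policy,
    (forall t s', D s' (pi t s')) /\ is_expected_payoff g pi s e].

(* Values are finite as soon as g is bounded on the nonempty sets D s, so that
   [fine] is harmless. *)
Definition action_value (r : S -> A -> R) (V : S -> \bar R) (s : S) (a : A) : R
  := r s a + gamma * \sum_s' q s a s' * fine (V s').

Definition rmdp_value (r : S -> A -> R) (phi : S -> {ffun A -> R} -> R) :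
    S -> \bar R :=
  value (fun=> simplex R A) (fun s a p => r s a + phi s p).

Definition rmdp_optimal (r : S -> A -> R) (phi : S -> {ffun A -> R} -> R)
    (pi : policy) : Prop :=
  forall s, is_argmax (simplex R A)
    (fun p => \sum_a p a * action_value r (rmdp_value r phi) s a + phi s p)
    (pi s).

Definition ctmdp_value (r : S -> A -> R) (D : S -> set {ffun A -> R}) :
    S -> \bar R :=
  value D (fun s a _ => r s a).

Definition ctmdp_optimal (r : S -> A -> R) (D : S -> set {ffun A -> R})
    (pi : policy) : Prop :=
  forall s, is_argmax (D s)
    (fun p => \sum_a p a * action_value r (ctmdp_value r D) s a) (pi s).

End MDP.

(* Main.v *)
Require Import Defs.
From HB Require Import structures.
From mathcomp Require Import all_boot all_order all_algebra.
From mathcomp Require Import all_classical all_reals all_analysis.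
From mathcomp Require Import measurable_realfun.
From mathcomp Require Import ring lra.

Set Implicit Arguments.
Unset Strict Implicit.
Unset Printing Implicit Defensive.

Import Order.TTheory GRing.Theory Num.Theory.
Import numFieldNormedType.Exports.

Local Open Scope classical_set_scope.
Local Open Scope ring_scope.

(** The constants are [c s = - phi s (pi_opt s)] for an optimal policy [pi_opt]
    of the regularized problem: each constraint [- phi s p <= c s] is then
    active at [pi_opt s]. Let [V] be the regularized value. On the feasible set
    [- c s <= phi s p], so the constrained Bellman objective
    [\sum_a p a * Q s a - c s] lies below the regularized one
    [\sum_a p a * Q s a + phi s p], and the two agree at [pi_opt s], which
    maximizes the larger one. Hence [V] also solves the Bellman equation of the
    constrained problem, so the two values coincide; and a constrained
    maximizer is a maximizer of the regularized objective, which is unique by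
    strict concavity ([argmax_unique]). If there is no optimal policy, any
    constants that make the feasible sets nonempty will do.

    What remains is to connect values, which are suprema of expectations over
    trajectories, with Bellman equations. Under time-dependent Markov policies
    the expected payoff is the sum [payoff] of the discounted one-time
    expectations ([expected_payoffE]): the law of the prefixes yields the
    Markov property, and boundedness of the stage payoff gives dominated
    convergence. For the regularized problem boundedness comes from concavity
    on the simplex ([concave_bounded]). That each policy does have a trajectory
    is shown by reading a Markov chain off the digits of a uniform random
    number, in a mixed expansion adapted to the transition probabilities
    ([markov_chain_law]).

    The payoff satisfies a one-step recursion, and discounting turns one-step
    inequalities into comparisons with it ([payoff_le], [payoff_ge]). They give
    the two facts used about values: a solution of the Bellman equation
    that is attained by a policy is the value ([value_of_solution]), and the
    value solves the equation once a greedy policy exists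
    ([value_of_greedy]). *)

(** * Sampling from a finite distribution *)

Section InverseTransform.
Variables (R : realType) (X : eqType) (p : X -> R).

(** The weights [p] lay out consecutive half-open intervals along the list [s];
    [offset s x] is where the interval of [x] begins. *)
Fixpoint offset (s : seq X) (x : X) : R :=
  if s is y :: s' then if x == y then 0 else p y + offset s' x else 0.

(** Besides the point whose interval contains [u], the position of [u] inside
    that interval is returned, rescaled to [0, 1[. It serves as the random
    source of the next draw. The pair [(x0, 0)] is returned only when [u] lies
    beyond the total mass. *)
Fixpoint sample (x0 : X) (s : seq X) (u : R) : X * R :=
  if s is y :: s' then
    if u < p y then (y, u / p y) else sample x0 s' (u - p y)
  else (x0, 0).

Hypothesis p_ge0 : forall x, 0 <= p x.

Lemma offset_ge0 s x : 0 <= offset s x.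
Proof. by elim: s => //= y s IHs; case: eqP => // _; rewrite addr_ge0. Qed.

Lemma offset_le s x : x \in s -> offset s x + p x <= \sum_(y <- s) p y.
Proof.
elim: s => //= y s IHs; rewrite inE big_cons; case: eqP => [->|_] /= => [_|].
  by rewrite add0r lerDl sumr_ge0.
by move=> /IHs; rewrite -addrA lerD2l.
Qed.

Lemma offset_inj s x y u : x \in s -> y \in s ->
  offset s x <= u < offset s x + p x -> offset s y <= u < offset s y + p y ->
  x = y.
Proof.
elim: s u => //= z s IHs u; rewrite !inE.
have := offset_ge0 s x; have := offset_ge0 s y.
case: eqP => [->|_]; case: eqP => [->|_] //= oy ox xs ys ux uy.
- by exfalso; lra.
- by exfalso; lra.
- by apply: (IHs (u - p z)) => //; lra.
Qed.

Lemma sampleP x0 s u : uniq s -> 0 <= u < \sum_(y <- s) p y ->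
  let z := sample x0 s u in
  [/\ z.1 \in s, offset s z.1 <= u < offset s z.1 + p z.1 &
      z.2 = (u - offset s z.1) / p z.1].
Proof.
elim: s u => [|y s IHs] u /=; first by rewrite big_nil; lra.
rewrite big_cons => /andP[ys us] u_range.
case: ltP => uy /=; first by rewrite eqxx mem_head subr0; split=> //; lra.
have /= [|zs z_itv ->] := IHs (u - p y) us; first by lra.
rewrite inE zs orbT; case: eqP => [zy|_]; first by rewrite -zy zs in ys.
by split=> //; [lra | congr (_ / _); ring].
Qed.

Lemma sampleE x0 s u x : uniq s -> x \in s ->
  0 <= u < \sum_(y <- s) p y ->
  (sample x0 s u).1 = x <-> offset s x <= u < offset s x + p x.
Proof.
move=> us xs u_range; have [zs z_itv _] := sampleP x0 us u_range.
by split=> [<- //|x_itv]; exact: (@offset_inj s _ _ u).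
Qed.

End InverseTransform.

(** * A Markov chain on the unit interval *)

(** On [A], membership in [B] is a function of the finite-valued [F], so that
    [A `&` B] is a finite union of fibres of [F]. *)
Lemma measurable_finitely_determined d (T : measurableType d)
    (I : finType) (A B : set T) (F : T -> I) :
  (forall i, measurable (A `&` F @^-1` [set i])) ->
  (forall w w', A w -> A w' -> F w = F w' -> B w -> B w') ->
  measurable (A `&` B).
Proof.
move=> mF FB.
pose G i := if `[< exists w, [/\ A w, F w = i & B w] >]
            then A `&` F @^-1` [set i] else set0.
have -> : A `&` B = \bigcup_i G i.
  apply/seteqP; split=> [w [Aw Bw]|w [i _]].
    by exists (F w) => //; rewrite /G ifT //; apply/asboolP; exists w.
  rewrite /G; case: asboolP => // -[w' [Aw' Fw' Bw']] [Aw /= Fw].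
  by split=> //; apply: (FB w') => //; rewrite Fw.
apply: countable_bigcupT_measurable => // i; rewrite /G.
by case: asboolP.
Qed.

Section MarkovChain.
Variables (R : realType) (X : finType).
Variables (mu : X -> R) (K : nat -> X -> X -> R).
Hypothesis mu_ge0 : forall x, 0 <= mu x.
Hypothesis mu_sum : \sum_x mu x = 1.
Hypothesis K_ge0 : forall t x y, 0 <= K t x y.
Hypothesis K_sum : forall t x, \sum_y K t x y = 1.

Definition chain_prob n (h : nat -> X) : R :=
  mu (h 0%N) * \prod_(0 <= t < n) K t (h t) (h t.+1).

Variable x0 : X.

(** A state of the chain paired with the part of [u] not consumed so far. *)
Fixpoint chain (u : R) (t : nat) : X * R :=
  if t is t'.+1 then
    let z := chain u t' in sample (K t' z.1) x0 (enum X) z.2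
  else sample mu x0 (enum X) u.

Lemma chain_prob_ge0 n h : 0 <= chain_prob n h.
Proof. by rewrite mulr_ge0 // prodr_ge0. Qed.

(** Each draw selects a subinterval of the current interval, shrunk by the
    transition probability. By induction a cylinder is therefore an interval
    whose length is its prescribed probability, and the source left over after
    [n] steps is the rescaled position in it. The last clause identifies
    the source of the next draw in the induction. *)
Lemma chain_cylinder n h : exists L,
  [/\ 0 <= L, L + chain_prob n h <= 1 &
   forall u, 0 <= u < 1 ->
    ((forall t, (t <= n)%N -> (chain u t).1 = h t) <->
      L <= u < L + chain_prob n h) /\
    (L <= u < L + chain_prob n h ->
      (chain u n).2 = (u - L) / chain_prob n h)].
Proof.
have enumU := enum_uniq X; have inX x : x \in enum X by rewrite mem_enum.
have sum1 (p : X -> R) : \sum_x p x = 1 -> \sum_(x <- enum X) p x = 1.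
  by move=> <-; rewrite big_enum.
elim: n => [|n [L [L_ge0 L_le1 IH]]].
  have prob0 : chain_prob 0 h = mu (h 0%N).
    by rewrite /chain_prob big_geq ?mulr1.
  exists (offset mu (enum X) (h 0%N)).
  rewrite prob0 offset_ge0 //; split => //.
    by rewrite -(sum1 mu) //; exact: offset_le.
  move=> u u01; have u_range : 0 <= u < \sum_(x <- enum X) mu x by rewrite sum1.
  have E := sampleE mu_ge0 x0 enumU (inX (h 0%N)) u_range; split.
    rewrite -E; split=> [/(_ 0%N (leqnn _)) //|hE t].
    by rewrite leqn0 => /eqP ->.
  by rewrite -E => zE; have [_ _] := sampleP x0 enumU u_range; rewrite zE.
set P := chain_prob n h in L_le1 IH *.
have P_ge0 : 0 <= P := chain_prob_ge0 n h.
set k := K n (h n) (h n.+1).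
have probS : chain_prob n.+1 h = P * k.
  by rewrite /P /chain_prob big_nat_recr //= mulrA.
set o := offset (K n (h n)) (enum X) (h n.+1).
have o_ge0 : 0 <= o by rewrite offset_ge0.
have k_ge0 : 0 <= k by rewrite /k.
have o_le1 : o + k <= 1 by rewrite -(sum1 _ (K_sum n (h n))); exact: offset_le.
have Po := mulr_ge0 P_ge0 o_ge0; have Pk := mulr_ge0 P_ge0 k_ge0.
have Pok : P * o + P * k <= P by rewrite -mulrDr -[leRHS]mulr1 ler_wpM2l.
exists (L + P * o); rewrite probS; split; [lra|lra|] => u u01.
have [IH1 IH2] := IH u u01.
have step : L <= u < L + P -> (chain u n).1 = h n ->
   let v := (u - L) / P in
   chain u n.+1 = sample (K n (h n)) x0 (enum X) v /\ 0 <= v < 1.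
  move=> uL hn v; rewrite /= hn (IH2 uL); split=> //.
  have P_gt0 : 0 < P by lra.
  by rewrite /v divr_ge0 ?ltr_pdivrMr //=; lra.
(* The interval of the next state, seen from the rescaled position and seen
   from [u] itself. *)
have scale : 0 < P -> (o <= (u - L) / P < o + k) =
   (L + P * o <= u < L + P * o + P * k).
  by move=> P_gt0; rewrite ler_pdivlMr // ltr_pdivrMr //; lra.
have sub : L + P * o <= u < L + P * o + P * k -> L <= u < L + P by lra.
have fwd : (forall t, (t <= n.+1)%N -> (chain u t).1 = h t) <->
    L + P * o <= u < L + P * o + P * k.
  split=> hE.
    have uL : L <= u < L + P by apply/IH1 => t tn; apply: hE; exact: leqW.
    have [cS v01] := step uL (hE n (leqnSn n)).
    rewrite -scale; last by lra.
    by apply/(sampleE (K_ge0 n (h n)) x0) => //;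
      rewrite ?sum1 // -cS; exact: hE.
  have uL := sub hE; move/IH1: (uL) => hn.
  have [cS v01] := step uL (hn n (leqnn n)).
  move=> t; rewrite leq_eqVlt => /predU1P[->|]; last by exact: hn.
  rewrite cS; apply/(sampleE (K_ge0 n (h n)) x0) => //; rewrite ?sum1 //.
  by rewrite scale //; lra.
split=> // hE; have uL := sub hE; move/IH1: (uL) => hn.
have [cS v01] := step uL (hn n (leqnn n)).
have P_gt0 : 0 < P by lra.
rewrite cS; have v_range : 0 <= (u - L) / P < \sum_(x <- enum X) K n (h n) x.
  by rewrite sum1.
have [_ _ ->] := sampleP x0 enumU v_range.
have -> : (sample (K n (h n)) x0 (enum X) ((u - L) / P)).1 = h n.+1.
  by rewrite -cS; apply: (fwd.2 hE).
have Pk_gt0 : 0 < P * k by lra.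
have k_gt0 : 0 < k by move: Pk_gt0; rewrite pmulr_rgt0.
by rewrite -/o -/k; field; rewrite !gt_eqF.
Qed.

Lemma uniform_prob_itvco (L l : R) : 0 <= L -> 0 <= l -> L + l <= 1 ->
  uniform_prob (@ltr01 R) `[L, L + l[%classic = l%:E.
Proof.
move=> L0 l0 Ll; rewrite /uniform_prob.
rewrite (eq_integral (fun=> 1%E)); last first.
  move=> x; rewrite inE /= in_itv /= => xL.
  by rewrite /uniform_pdf ifT; [rewrite subr0 invr1 | lra].
rewrite integral_cst //= mul1e lebesgue_measure_itv /= lte_fin.
by case: ltP => ll; rewrite -?EFinB; congr EFin; lra.
Qed.

(** Points outside [0, 1[ form a null set; sending them to [0] keeps the
    states measurable on the whole line. *)
Definition chain_state (t : nat) (u : R) : X :=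
  (chain (if 0 <= u < 1 then u else 0) t).1.

(** Every time-inhomogeneous Markov chain with finitely many states lives on
    the unit interval with its uniform measure: cylinders are intervals of the
    right length, hence also measurable. *)
Lemma markov_chain_law :
  (forall t x, measurable (chain_state t @^-1` [set x])) /\
  (forall n h, uniform_prob (@ltr01 R)
     [set w | forall t, (t <= n)%N -> chain_state t w = h t]
   = (chain_prob n h)%:E).
Proof.
pose U : set R := `[0, 1[%classic.
have mU : measurable U by exact: measurable_itv.
have cyl n h : exists L, [/\ 0 <= L, L + chain_prob n h <= 1 &
    U `&` [set w | forall t, (t <= n)%N -> chain_state t w = h t]
     = `[L, L + chain_prob n h[%classic].
  have [L [L0 L1 E]] := chain_cylinder n h; exists L; split=> //.
  apply/seteqP; split=> u; rewrite /U /= !in_itv /=.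
    by case=> u01; rewrite /chain_state u01 => /(E u u01).1.
  move=> uL; have u01 : 0 <= u < 1 by lra.
  by split=> // t tn; rewrite /chain_state u01; apply: ((E u u01).1.2 uL).
have outside u : ~ U u -> forall t, chain_state t u = chain_state t 0.
  move=> /negP; rewrite /U /= in_itv /= => /negbTE uU t.
  by rewrite /chain_state uU lexx ltr01.
have mst t x : measurable (chain_state t @^-1` [set x]).
  pose past u := [ffun i : 'I_t.+1 => chain_state i u].
  rewrite -(setIT (_ @^-1` _)) -(setUv U) setIUr.
  apply: measurableU; rewrite setIC.
    apply: (@measurable_finitely_determined _ _ _ _ _ past).
      move=> h; have [L [_ _]] := cyl t (fun i => h (inord i)).
      rewrite (_ : [set w | _] = past @^-1` [set h]) => [->|].
        exact: measurable_itv.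
      apply/seteqP; split=> w /=.
        by move=> wh; apply/ffunP => i; rewrite ffunE wh ?inord_val // -ltnS.
      by move=> <- i it; rewrite ffunE inordK.
    by move=> w w' _ _ /ffunP/(_ ord_max); rewrite !ffunE /= => ->.
  apply: (@measurable_finitely_determined _ _ _ _ _ (fun=> tt)).
    case; rewrite (_ : _ @^-1` _ = setT) ?setIT; last by apply/seteqP.
    exact: measurableC.
  by move=> w w' /outside/(_ t) /= -> /outside/(_ t) -> _.
split=> // n h; have [L [L0 L1 E]] := cyl n h.
set A := [set w | _] in E *.
have mA : measurable A.
  rewrite (_ : A = \bigcap_t
      (if (t <= n)%N then chain_state t @^-1` [set h t] else setT)).
    by apply: bigcapT_measurable => t; case: ifP.
  apply/seteqP; split=> w /= wA t.
    by move=> _; case: ifP => //; exact: wA.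
  by move=> tn; move: (wA t I); rewrite tn.
have PU : uniform_prob (@ltr01 R) U = 1%E.
  have := @uniform_prob_itvco 0 1 (lexx 0) ler01.
  by rewrite add0r; apply.
have PC : uniform_prob (@ltr01 R) (A `&` ~` U) = 0%E.
  apply: (@subset_measure0 _ _ _ (uniform_prob (@ltr01 R)) _ (~` U)) => //.
  - by apply: measurableI => //; exact: measurableC.
  - exact: measurableC.
  - have := probability_setC (uniform_prob (@ltr01 R)) mU.
    by rewrite [X in (_ - X)%E]PU subee.
rewrite -(setIT A) -(setUv U) setIUr measureU //.
- transitivity (uniform_prob (@ltr01 R) (A `&` U) + 0)%E.
    by congr (_ + _)%E; exact: PC.
  by rewrite adde0 setIC E uniform_prob_itvco //; exact: chain_prob_ge0.
- exact: measurableI.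
- by apply: measurableI => //; exact: measurableC.
- by rewrite setIACA setICr setI0.
Qed.

End MarkovChain.

(** * Finite-valued random variables *)

Lemma measure_finite_partition (R : realType) d (T : measurableType d)
    (mu : {measure set T -> \bar R}) (X : finType) (F : T -> X) (A : set T) :
  measurable A -> (forall x, measurable (F @^-1` [set x])) ->
  mu A = (\sum_x mu (A `&` F @^-1` [set x]))%E.
Proof.
move=> mA mF.
have {1}-> : A = \bigcup_(x in [set: X]) (A `&` F @^-1` [set x]).
  by apply/seteqP; split=> [w Aw|w [x _ [Aw _]] //]; exists (F w).
rewrite measure_fin_bigcup //.
- rewrite -big_enum /= [RHS]fsbig_seq ?enum_uniq //.
  rewrite (_ : [set` enum X] = setT) //.
  by apply/seteqP; split=> x //= _; rewrite mem_enum.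
- exact: finite_finset.
- by apply/trivIsetP => x y _ _ xy; apply/seteqP; split=> w //= [[_ wx] [_ wy]];
    rewrite -wx -wy eqxx in xy.
- by move=> x _; exact: measurableI.
Qed.

Lemma fun_finiteE (R : realType) (T : Type) (X : finType) (F : X -> R)
    (tau : T -> X) :
  F \o tau = fun w => \sum_x F x * \1_(tau @^-1` [set x]) w.
Proof.
apply/funext => w /=; rewrite (bigD1 (tau w)) //= indicE mem_set // mulr1.
rewrite big1 ?addr0 // => x /eqP xt; rewrite indicE memNset ?mulr0 //=.
by move=> tx; apply: xt.
Qed.

Lemma measurable_fun_finite (R : realType) d (T : measurableType d)
    (X : finType) (F : X -> R) (tau : T -> X) :
  (forall x, measurable (tau @^-1` [set x])) ->
  measurable_fun [set: T] (F \o tau).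
Proof.
move=> mtau; rewrite fun_finiteE; apply: measurable_sum => x.
by apply: measurable_funM => //; exact: measurable_indic.
Qed.

Lemma integral_finite (R : realType) d (T : measurableType d)
    (P : probability T R) (X : finType) (F : X -> R) (tau : T -> X) :
  (forall x, measurable (tau @^-1` [set x])) ->
  (\int[P]_w (F (tau w))%:E = \sum_x (F x)%:E * P (tau @^-1` [set x]))%E.
Proof.
move=> mtau.
have mI x : measurable_fun [set: T] (fun w => F x * \1_(tau @^-1` [set x]) w).
  by apply: measurable_funM => //; exact: measurable_indic.
have II x : P.-integrable [set: T] (EFin \o \1_(tau @^-1` [set x])).
  by apply: integrable_indic.
under eq_integral => w _.
  rewrite (_ : F (tau w) = (F \o tau) w) // fun_finiteE -sumEFin.
  over.
rewrite integral_sum //=; last first.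
  by move=> x; exact: (integrableZl measurableT (F x) (II x)).
apply: eq_bigr => x _.
under eq_integral do rewrite EFinM.
by rewrite (integralZl measurableT (II x)) integral_indic ?setIT.
Qed.

(** * The law of a trajectory *)

Section Trajectory.
Variables (R : realType) (S A : finType).
Variable q : S -> A -> {ffun S -> R}.
Hypothesis q_prob : forall s a, simplex R S (q s a).

Implicit Types (pi : nat -> policy R S A) (p : policy R S A).
Implicit Types (f : S -> R) (g : S -> A -> {ffun A -> R} -> R).

Definition trans p f s : R := \sum_a p s a * \sum_s' q s a s' * f s'.

Definition reward g p s : R := \sum_a p s a * g s a (p s).

(** The expectation of [f s_n] as a function of the initial state. Peeling off
    the first policy first makes this recursion follow the Bellman equation. *)
Fixpoint propagate pi n f : S -> R :=
  if n is n'.+1 then trans (pi 0%N) (propagate (fun t => pi t.+1) n' f) else f.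

Lemma propagateSr pi n f :
  propagate pi n.+1 f = propagate pi n (trans (pi n) f).
Proof. by elim: n pi => //= n IHn pi; rewrite -IHn. Qed.

(** Trajectories are sequences of state-action pairs, and under time-dependent
    Markov policies they form a Markov chain with the following initial law and
    transition kernels. *)
Definition initial pi (s0 : S) (x : S * A) : R :=
  (x.1 == s0)%:R * pi 0%N x.1 x.2.

Definition kernel pi t (x y : S * A) : R :=
  q x.1 x.2 y.1 * pi t.+1 y.1 y.2.

Lemma prefix_prob_chain pi s0 n h :
  prefix_prob q pi s0 n h = chain_prob (initial pi s0) (kernel pi) n h.
Proof.
rewrite /prefix_prob /chain_prob /initial big_nat_recl //= -!mulrA.
do 2 congr (_ * _); rewrite -big_split /=; apply: eq_bigr => t _.
by rewrite mulrC.
Qed.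

Lemma sum_pair_prob (p : policy R S A) (w F : S * A -> R) (d : S -> R) :
  (forall x, w x = d x.1 * p x.1 x.2) ->
  \sum_x w x * F x = \sum_s d s * \sum_a p s a * F (s, a).
Proof.
move=> wE; rewrite (eq_bigr (fun x => w (x.1, x.2) * F (x.1, x.2))) => [|[] //].
rewrite -(pair_bigA _ (fun s a => w (s, a) * F (s, a))) /=.
by apply: eq_bigr => s _; rewrite big_distrr /=; apply: eq_bigr => a _;
  rewrite wE mulrA.
Qed.

Lemma trajectory_exists pi s0 :
  (0 < #|A|)%N -> (forall t s, simplex R A (pi t s)) ->
  exists d (Omega : measurableType d) (P : probability Omega R)
         (tau : nat -> Omega -> S * A), is_trajectory q pi s0 P tau.
Proof.
case/card_gt0P => a0 _ pi_prob.
have init_ge0 x : 0 <= initial pi s0 x by rewrite mulr_ge0 ?(pi_prob _ _).1.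
have ker_ge0 t x y : 0 <= kernel pi t x y.
  by rewrite mulr_ge0 ?(pi_prob _ _).1 ?(q_prob _ _).1.
have init_sum : \sum_x initial pi s0 x = 1.
  under eq_bigr do rewrite -[initial _ _ _]mulr1.
  rewrite (@sum_pair_prob (pi 0%N) _ (fun=> 1) (fun s => (s == s0)%:R)) //.
  rewrite (bigD1 s0) //= eqxx mul1r [X in _ + X]big1 ?addr0 => [|s /negbTE ->].
    by under eq_bigr do rewrite mulr1; exact: (pi_prob _ _).2.
  by rewrite mul0r.
have ker_sum t x : \sum_y kernel pi t x y = 1.
  under eq_bigr do rewrite -[kernel _ _ _ _]mulr1.
  rewrite (@sum_pair_prob (pi t.+1) _ (fun=> 1) (q x.1 x.2)) //.
  rewrite -[RHS](q_prob x.1 x.2).2; apply: eq_bigr => s _.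
  by under eq_bigr do rewrite mulr1; rewrite (pi_prob _ _).2 mulr1.
have [mtau law] :=
  markov_chain_law init_ge0 init_sum ker_ge0 ker_sum (s0, a0).
exists _, _, (uniform_prob (@ltr01 R)),
  (chain_state (initial pi s0) (kernel pi) (s0, a0)).
by split=> // n h; rewrite prefix_prob_chain; exact: law.
Qed.

Section Law.
Variables (pi : nat -> policy R S A) (s0 : S).
Variables (d : measure_display) (Omega : measurableType d).
Variables (P : probability Omega R) (tau : nat -> Omega -> S * A).
Hypothesis trajectory : is_trajectory q pi s0 P tau.

Let mtau t x : measurable (tau t @^-1` [set x]) := trajectory.1 t x.

(* Constraining the chain at times [k] to [n] only interpolates between the
   cylinders ([k = 0]), whose probabilities are given, and the one-time
   marginals ([k = n]). *)
Let segment k n h : set Omega :=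
  [set w | forall t, (k <= t <= n)%N -> tau t w = h t].

Let measurable_segment k n h : measurable (segment k n h).
Proof.
rewrite (_ : segment k n h = \bigcap_t
    (if (k <= t <= n)%N then tau t @^-1` [set h t] else setT)).
  by apply: bigcapT_measurable => t; case: ifP.
apply/seteqP; split=> w /= sw t; first by move=> _; case: ifP => //; exact: sw.
by move=> tn; move: (sw t I); rewrite tn.
Qed.

(** The Markov property. For [k = 0] it is the product formula for prefixes;
    increasing [k] amounts to summing over the value at time [k]. *)
Lemma segment_step k n h : (k <= n)%N ->
  P (segment k n.+1 h) =
    (P (segment k n h) * (kernel pi n (h n) (h n.+1))%:E)%E.
Proof.
elim: k h => [|k IHk] h kn.
  have E m : P (segment 0 m h) = (prefix_prob q pi s0 m h)%:E.
    by rewrite -trajectory.2.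
  rewrite !E !prefix_prob_chain -EFinM /chain_prob big_nat_recr //=.
  by rewrite mulrA.
pose hk x t := if t == k then x else h t.
have split_k m : (k < m)%N ->
    P (segment k.+1 m h) = (\sum_x P (segment k m (hk x)))%E.
  move=> km; rewrite (measure_finite_partition P _ (mtau k)) //.
  apply: eq_bigr => x _; congr (P _); apply/seteqP; split=> w /=.
    case=> hw kw t /andP[kt tm]; rewrite /hk; case: eqP => [->|/eqP tk] //.
    by apply: hw; rewrite ltn_neqAle eq_sym tk kt.
  move=> hw; split=> [t /andP[kt tm]|].
    by rewrite hw /hk ?(gtn_eqF kt) // ltnW.
  by rewrite hw /hk ?eqxx // leqnn ltnW.
rewrite !split_k //; last exact: leqW.
rewrite ge0_sume_distrl => [|x _ //]; apply: eq_bigr => x _.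
by rewrite IHk ?(ltnW kn) // /hk (gtn_eqF kn) (gtn_eqF (leqW kn)).
Qed.

Let marginal n x : R := fine (P (tau n @^-1` [set x])).

Let marginalE n x : P (tau n @^-1` [set x]) = (marginal n x)%:E.
Proof. by rewrite fineK // fin_num_measure. Qed.

Let marginal0 x : marginal 0 x = initial pi s0 x.
Proof.
rewrite /marginal (_ : _ @^-1` _ =
    [set w | forall t, (t <= 0)%N -> tau t w = (fun=> x) t]).
  by rewrite trajectory.2 prefix_prob_chain /chain_prob big_geq // mulr1.
apply/seteqP; split=> w /= wx; last exact: wx.
by move=> t; rewrite leqn0 => /eqP ->.
Qed.

Let marginalS n y :
  marginal n.+1 y = \sum_x marginal n x * kernel pi n x y.
Proof.
apply: EFin_inj; rewrite -marginalE.
rewrite (measure_finite_partition P _ (mtau n)) // -sumEFin.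
apply: eq_bigr => x _; rewrite EFinM -marginalE.
pose h t := if t == n then x else y.
have hn : h n = x by rewrite /h eqxx.
have hS : h n.+1 = y by rewrite /h (gtn_eqF (ltnSn n)).
have := segment_step h (leqnn n); rewrite hn hS => E.
have <- : segment n n.+1 h = tau n.+1 @^-1` [set y] `&` tau n @^-1` [set x].
  apply/seteqP; split=> w /=.
    by move=> hw; rewrite -hn -hS; split; apply: hw; rewrite leqnn leqnSn.
  case=> wS wn t /andP[nt]; rewrite leq_eqVlt => /predU1P[->|tn].
    by rewrite hS.
  by have -> : t = n; [apply/eqP; rewrite eqn_leq nt andbT -ltnS | rewrite hn].
have <- : segment n n h = tau n @^-1` [set x].
  apply/seteqP; split=> w /=.
    by move=> /(_ n); rewrite leqnn hn; apply.
  by move=> wn t; rewrite -eqn_leq => /eqP <-; rewrite hn.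
exact: E.
Qed.

(* Stated for an arbitrary [F] because the induction replaces [F] by its
   conditional expectation given the previous pair. *)
Let expectation_marginal n (F : S * A -> R) :
  \sum_x marginal n x * F x =
    propagate pi n (fun s => \sum_a pi n s a * F (s, a)) s0.
Proof.
elim: n F => [|n IHn] F.
  rewrite /= (@sum_pair_prob (pi 0%N) _ F (fun s => (s == s0)%:R)); last first.
    exact: marginal0.
  rewrite (bigD1 s0) //= eqxx mul1r [X in _ + X]big1 ?addr0 // => s /negbTE ->.
  by rewrite mul0r.
rewrite propagateSr.
transitivity (\sum_x marginal n x * \sum_y kernel pi n x y * F y).
  under eq_bigr do rewrite marginalS big_distrl.
  rewrite exchange_big /=; apply: eq_bigr => x _.
  by rewrite big_distrr /=; apply: eq_bigr => y _; rewrite mulrA.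
rewrite IHn; congr (propagate _ _ _ _); apply/funext => s.
apply: eq_bigr => a _; congr (_ * _).
by rewrite (@sum_pair_prob (pi n.+1) _ F (q s a)).
Qed.

Lemma integral_trajectory n (F : S * A -> R) :
  (\int[P]_w (F (tau n w))%:E =
    (propagate pi n (fun s => \sum_a pi n s a * F (s, a)) s0)%:E)%E.
Proof.
rewrite integral_finite // -expectation_marginal -sumEFin.
by apply: eq_bigr => x _; rewrite marginalE -EFinM mulrC.
Qed.

End Law.

End Trajectory.

(** * Discounted payoffs and the Bellman backup *)

Section PolicyEvaluation.
Variables (R : realType) (S A : finType).
Variables (q : S -> A -> {ffun S -> R}) (gamma : R).
Hypothesis q_prob : forall s a, simplex R S (q s a).
Hypothesis gamma01 : 0 <= gamma < 1.

Implicit Types (pi : nat -> policy R S A) (p : policy R S A).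
Implicit Types (f W : S -> R) (g : S -> A -> {ffun A -> R} -> R).
Notation trans := (trans q).
Notation propagate := (propagate q).

Lemma mean_le (T : finType) (w : {ffun T -> R}) (F G : T -> R) :
  simplex R T w -> (forall x, F x <= G x) ->
  \sum_x w x * F x <= \sum_x w x * G x.
Proof. by move=> [w_ge0 _] FG; apply: ler_sum => x _; exact: ler_wpM2l. Qed.

Lemma mean_cst (T : finType) (w : {ffun T -> R}) (C : R) :
  simplex R T w -> \sum_x w x * C = C.
Proof. by move=> [_ w1]; rewrite -big_distrl /= w1 mul1r. Qed.

Lemma mean_norm_le (T : finType) (w : {ffun T -> R}) (F : T -> R) (C : R) :
  simplex R T w -> (forall x, `|F x| <= C) -> `|\sum_x w x * F x| <= C.
Proof.
move=> w_prob FC; rewrite ler_norml -{1}(mean_cst (- C) w_prob).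
rewrite -{2}(mean_cst C w_prob).
by apply/andP; split; apply: mean_le => // x; move: (FC x); rewrite ler_norml;
  case/andP.
Qed.

Lemma cvg_sum_fin (T : finType) (w : T -> R) (u : T -> nat -> R) (l : T -> R) :
  (forall x, u x @ \oo --> l x) ->
  (fun n => \sum_x w x * u x n) @ \oo --> \sum_x w x * l x.
Proof.
move=> ul.
elim: (index_enum T) => [|x r IHr].
  by rewrite big_nil; under eq_fun do rewrite big_nil; exact: cvg_cst.
rewrite big_cons; under eq_fun do rewrite big_cons.
by apply: cvgD => //; apply: cvgM => //; exact: cvg_cst.
Qed.

(** The second conclusion provides a constant that dominates all partial
    sums, as needed both for bounding payoffs and for exchanging limit and
    expectation. *)
Lemma geometric_domination (u : nat -> R) (M : R) :
  (forall n, `|u n| <= M * gamma ^+ n) ->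
  cvgn (series u) /\ forall n, `|series u n| <= M / (1 - gamma).
Proof.
case/andP: gamma01 => gamma_ge0 gamma_lt1 uM.
have M_ge0 : 0 <= M by have := uM 0%N; rewrite expr0 mulr1; exact: le_trans.
split=> [|n].
  apply: normed_cvg; apply: (@series_le_cvg _ _ (geometric M gamma)) => //.
  - by move=> n; exact: normr_ge0.
  - by move=> n; exact: geometric_ge0.
  - by apply: is_cvg_geometric_series; rewrite ger0_norm.
apply: le_trans (ler_norm_sum _ _ _) _.
apply: (@le_trans _ _ (series (geometric M gamma) n)); first exact: ler_sum.
rewrite geometric_seriesE ?lt_eqF //= ler_pM2r ?invr_gt0 ?subr_gt0 //.
by rewrite ler_piMr // gerBl exprn_ge0.
Qed.

Lemma trans_norm_le p f C s : (forall s, simplex R A (p s)) ->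
  (forall s, `|f s| <= C) -> `|trans p f s| <= C.
Proof.
move=> p_prob fC; apply: mean_norm_le => // a; exact: mean_norm_le.
Qed.

Lemma propagate_norm_le pi n f C s : (forall t s, simplex R A (pi t s)) ->
  (forall s, `|f s| <= C) -> `|propagate pi n f s| <= C.
Proof.
elim: n pi s => [|n IHn] pi s pi_prob fC //=.
by apply: trans_norm_le => // s'; apply: IHn.
Qed.

Definition payoff g pi s : R :=
  limn (series (fun t => gamma ^+ t * propagate pi t (reward g (pi t)) s)).

(** The right-hand side of the Bellman equation before maximization: [w] is
    the action distribution used now in [s], [W] the value of what follows. *)
Definition backup g W s (w : {ffun A -> R}) : R :=
  \sum_a w a * (g s a w + gamma * \sum_s' q s a s' * W s').

Definition admissible g M pi :=
  (forall t s, simplex R A (pi t s)) /\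
  (forall t s a, `|g s a (pi t s)| <= M).

Lemma backupE g W s p : backup g W s (p s) = reward g p s + gamma * trans p W s.
Proof.
rewrite /backup /reward /trans big_distrr -big_split /=.
by apply: eq_bigr => a _; rewrite mulrDr mulrCA.
Qed.

Lemma backup_le g W W' s w : simplex R A w -> (forall s, W s <= W' s) ->
  backup g W s w <= backup g W' s w.
Proof.
move=> w_prob WW'; apply: mean_le => // a; rewrite lerD2l.
by apply: ler_wpM2l; [case/andP: gamma01 | apply: mean_le].
Qed.

Lemma backupB g W W' s p :
  backup g W s (p s) - backup g W' s (p s)
    = gamma * trans p (fun s => W s - W' s) s.
Proof.
rewrite !backupE opprD addrACA subrr add0r -mulrBr /trans -sumrB.
congr (_ * _); apply: eq_bigr => a _; rewrite -mulrBr -sumrB; congr (_ * _).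
by apply: eq_bigr => s' _; rewrite mulrBr.
Qed.

Lemma payoff_term_le g M pi s t : admissible g M pi ->
  `|gamma ^+ t * propagate pi t (reward g (pi t)) s| <= M * gamma ^+ t.
Proof.
move=> [pi_prob gM]; case/andP: gamma01 => gamma_ge0 _.
rewrite normrM mulrC normrX (ger0_norm gamma_ge0) ler_wpM2r ?exprn_ge0 //.
by apply: propagate_norm_le => // s'; exact: mean_norm_le.
Qed.

Lemma payoff_cvg g M pi s : admissible g M pi ->
  series (fun t => gamma ^+ t * propagate pi t (reward g (pi t)) s) @ \oo
    --> payoff g pi s.
Proof.
by move=> adm; have [] := geometric_domination (fun t => payoff_term_le s t adm).
Qed.

Lemma payoff_norm_le g M pi s : admissible g M pi ->
  `|payoff g pi s| <= M / (1 - gamma).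
Proof.
move=> adm.
have [_ le_M] := geometric_domination (fun t => payoff_term_le s t adm).
have /cvg_norm cv := @payoff_cvg g M pi s adm.
by apply: (ler_cvg_to cv (cvg_cst _)); apply: nearW.
Qed.

Lemma admissible_shift g M pi n :
  admissible g M pi -> admissible g M (fun t => pi (n + t)%N).
Proof. by move=> [pi_prob gM]; split=> t; [exact: pi_prob | exact: gM]. Qed.

(** Conditioning on the first transition: the series splits into its first
    term and [gamma] times the series of the shifted policies, and finite
    averages commute with limits. *)
Lemma payoff_recursion g M pi s : admissible g M pi ->
  payoff g pi s = backup g (payoff g (fun t => pi t.+1)) s (pi 0%N s).
Proof.
move=> adm; have admS := admissible_shift 1 adm.
apply: cvg_lim; first exact: Rhausdorff.
rewrite -cvg_shiftS /=.
set pi' := fun t => pi t.+1.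
pose u s' :=
  series (fun t => gamma ^+ t * propagate pi' t (reward g (pi' t)) s').
rewrite (_ : (fun n => _) = fun n => backup g (u^~ n) s (pi 0%N s)).
  rewrite /backup; apply: cvg_sum_fin => a.
  apply: cvgD; first exact: cvg_cst.
  apply: cvgM; first exact: cvg_cst.
  by apply: cvg_sum_fin => s'; exact: (@payoff_cvg g M pi' s' admS).
apply/funext => n; rewrite backupE /series /= big_nat_recl //= mul1r.
congr (_ + _); rewrite /u /series /=.
under eq_bigr do rewrite exprS -mulrA.
rewrite -big_distrr /=; congr (_ * _).
rewrite /trans.
under eq_bigr do rewrite big_distrr /=.
rewrite exchange_big /=; apply: eq_bigr => a _.
under eq_bigr do rewrite mulrCA.
rewrite -big_distrr /=; congr (_ * _).
under eq_bigr do rewrite big_distrr /=.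
rewrite exchange_big /=; apply: eq_bigr => s' _.
by under eq_bigr do rewrite mulrCA; rewrite -big_distrr.
Qed.

(** Discounting as a contraction: iterating the inequality bounds [e] by
    [gamma ^+ n * C] for every [n]. *)
Lemma discounted_nonpos pi (e : nat -> S -> R) (C : R) :
  (forall t s, simplex R A (pi t s)) -> (forall t s, e t s <= C) ->
  (forall t s, e t s <= gamma * trans (pi t) (e t.+1) s) ->
  forall t s, e t s <= 0.
Proof.
case/andP: gamma01 => gamma_ge0 gamma_lt1 pi_prob eC eS t s.
have e_le n : e t s <= gamma ^+ n * C.
  elim: n t s => [|n IHn] t s; first by rewrite mul1r.
  apply: le_trans (eS t s) _; rewrite exprS -mulrA ler_wpM2l //.
  rewrite -[leRHS](mean_cst _ (pi_prob t s)); apply: mean_le => // a.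
  by rewrite -[leRHS](mean_cst _ (q_prob s a)); apply: mean_le.
have gamma0 : (fun n => gamma ^+ n * C) @ \oo --> 0 * C.
  by apply: cvgM; [apply: cvg_expr; rewrite ger0_norm | exact: cvg_cst].
by rewrite -(mul0r C); apply: (ler_cvg_to (cvg_cst _) gamma0); apply: nearW.
Qed.

(** A supersolution of the Bellman equation dominates the payoff: the excess
    of the payoffs of the successive shifts of [pi] over [W] contracts. *)
Lemma payoff_le g M pi W : admissible g M pi ->
  (forall t s, backup g W s (pi t s) <= W s) -> forall s, payoff g pi s <= W s.
Proof.
move=> adm W_ge s; rewrite -subr_le0.
pose from t : nat -> policy R S A := fun n => pi (t + n)%N.
have fromS t : (fun n => from t n.+1) = from t.+1.
  by apply/funext => n; rewrite /from addnS.
pose e t s := payoff g (from t) s - W s.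
apply: (@discounted_nonpos pi e (M / (1 - gamma) + \sum_s `|W s|) _ _ _ 0%N).
- by case: adm.
- move=> t s'; rewrite /e lerD //.
    apply: le_trans (ler_norm _) _.
    by apply: payoff_norm_le; exact: admissible_shift.
  rewrite (bigD1 s') //= (le_trans (ler_norm _)) // normrN lerDl.
  by rewrite sumr_ge0.
move=> t s'; rewrite /e.
rewrite (payoff_recursion s' (admissible_shift t adm)) fromS /from addn0.
apply: (@le_trans _ _ (backup g (payoff g (from t.+1)) s' (pi t s')
                       - backup g W s' (pi t s'))).
  by rewrite lerD2l lerN2.
by rewrite backupB.
Qed.

(** The same contraction applied to [W - payoff]. Under a stationary policy
    the payoff does not change with the shift. *)
Lemma payoff_ge g M p W : admissible g M (fun=> p) ->
  (forall s, W s <= backup g W s (p s)) ->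
  forall s, W s <= payoff g (fun=> p) s.
Proof.
move=> adm W_le s; rewrite -subr_le0.
pose J := payoff g (fun=> p); pose e (t : nat) s := W s - J s.
apply: (@discounted_nonpos (fun=> p) e
  (\sum_s `|W s| + M / (1 - gamma)) _ _ _ 0%N).
- by case: adm.
- move=> t s'; rewrite /e lerD //.
    by rewrite (bigD1 s') //= (le_trans (ler_norm _)) // lerDl sumr_ge0.
  apply: le_trans (ler_norm _) _; rewrite normrN.
  exact: payoff_norm_le.
move=> t s'; rewrite /e /J (payoff_recursion s' adm) -/J.
apply: (@le_trans _ _ (backup g W s' (p s') - backup g J s' (p s'))).
  by rewrite lerD2r.
by rewrite backupB.
Qed.

End PolicyEvaluation.

(** * Value functions *)

Section Value.
Variables (R : realType) (S A : finType).
Variables (q : S -> A -> {ffun S -> R}) (gamma : R).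
Hypothesis q_prob : forall s a, simplex R S (q s a).
Hypothesis gamma01 : 0 <= gamma < 1.

Implicit Types (pi : nat -> policy R S A) (p : policy R S A).
Implicit Types (f W : S -> R) (g : S -> A -> {ffun A -> R} -> R).
Notation payoff := (payoff q gamma).
Notation backup := (backup q gamma).

Lemma transZ c p f s : trans q p (fun s => c * f s) s = c * trans q p f s.
Proof.
rewrite /trans big_distrr /=; apply: eq_bigr => a _; rewrite mulrCA.
congr (_ * _); rewrite big_distrr /=; apply: eq_bigr => s' _.
exact: mulrCA.
Qed.

Lemma propagateZ c pi n f s :
  propagate q pi n (fun s => c * f s) s = c * propagate q pi n f s.
Proof.
elim: n pi s => //= n IHn pi s; rewrite -transZ.
by congr trans; apply/funext => s'.
Qed.

(** Dominated convergence: the expectation of the discounted sum is the limit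
    of finite sums, whose terms depend on the one-time marginals only. *)
Lemma expected_payoffE g M pi s0 e : admissible g M pi ->
  is_expected_payoff q gamma g pi s0 e -> e = (payoff g pi s0)%:E.
Proof.
move=> adm [d [ Omega [P [tau [traj ->]]]]]; rewrite unlock.
have /andP[gamma_ge0 gamma_lt1] := gamma01.
pose F t (x : S * A) := gamma ^+ t * g x.1 x.2 (pi t x.1).
pose f n w := series (fun t => F t (tau t w)) n.
have F_le w t : `|F t (tau t w)| <= M * gamma ^+ t.
  rewrite normrM mulrC normrX (ger0_norm gamma_ge0) ler_wpM2r ?exprn_ge0 //.
  exact: adm.2.
have f_bound w := geometric_domination gamma01 (F_le w).
have mF t : measurable_fun [set: Omega] (F t \o tau t).
  by apply: measurable_fun_finite; exact: traj.1.
have mf n : measurable_fun [set: Omega] (f n).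
  by rewrite /f /series; apply: measurable_sum => t; exact: mF.
have iF t : P.-integrable [set: Omega] (fun w => (F t (tau t w))%:E).
  apply: (le_integrable measurableT _ _
    (finite_measure_integrable_cst P (M * gamma ^+ t) measurableT)).
    by apply/measurable_EFinP; exact: mF.
  move=> w _ /=; rewrite lee_fin (le_trans (F_le w t)) // ler_norm //.
have If n : (\int[P]_w (f n w)%:E = (series (fun t =>
    gamma ^+ t * propagate q pi t (reward g (pi t)) s0) n)%:E)%E.
  rewrite /f /series /=; under eq_integral do rewrite -sumEFin.
  rewrite integral_sum //= -sumEFin; apply: eq_bigr => t _.
  rewrite (integral_trajectory traj) -propagateZ; congr (propagate _ _ _ _ _)%:E.
  apply/funext => s; rewrite /reward big_distrr /=; apply: eq_bigr => a _.
  by rewrite mulrCA.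
have cv : (\int[P]_w (f n w)%:E)%E @[n --> \oo] -->
    (\int[P]_w (discounted_payoff gamma g pi (fun t => tau t w))%:E)%E.
  apply: (@dominated_cvg _ _ _ P _ measurableT _ _ (fun=> (M / (1 - gamma))%:E)).
  - by move=> n; apply/measurable_EFinP; exact: mf.
  - move=> w _; apply/cvg_EFin; first by apply: nearW.
    exact: (f_bound w).1.
  - by [].
  - exact: finite_measure_integrable_cst.
  - by move=> n w _; rewrite /= lee_fin; exact: (f_bound w).2.
have cv' : (\int[P]_w (f n w)%:E)%E @[n --> \oo] --> (payoff g pi s0)%:E.
  under eq_fun do rewrite If.
  apply: cvg_EFin; first exact: nearW.
  exact: (@payoff_cvg _ _ _ q gamma q_prob gamma01 g M pi s0 adm).
exact: (cvg_unique (@ereal_hausdorff R) cv cv').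
Qed.

Section ValueFunction.
Variables (D : S -> set {ffun A -> R}) (g : S -> A -> {ffun A -> R} -> R).
Variable M : R.
Hypothesis A_nonempty : (0 < #|A|)%N.
Hypothesis D_simplex : forall s, D s `<=` simplex R A.
Hypothesis g_bounded : forall s a w, D s w -> `|g s a w| <= M.

Let D_admissible pi : (forall t s, D s (pi t s)) -> admissible g M pi.
Proof.
by move=> piD; split=> t s => [|a]; [exact: D_simplex | exact: g_bounded].
Qed.

(** Trajectories have to exist here: a policy without any trajectory would not
    contribute to the supremum. *)
Lemma payoff_le_value pi s : (forall t s', D s' (pi t s')) ->
  ((payoff g pi s)%:E <= value q gamma D g s)%E.
Proof.
move=> piD; apply: ereal_sup_ubound; exists pi; split=> //.
have [d [ Omega [P [tau traj]]]] :=
  trajectory_exists q_prob s A_nonempty (D_admissible piD).1.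
have ee : is_expected_payoff q gamma g pi s
  ('E_P[fun w => discounted_payoff gamma g pi (fun t => tau t w)])%E.
  by exists d, Omega, P, tau.
by rewrite -(expected_payoffE (D_admissible piD) ee).
Qed.

Lemma value_le s (C : \bar R) :
  (forall pi, (forall t s', D s' (pi t s')) -> ((payoff g pi s)%:E <= C)%E) ->
  (value q gamma D g s <= C)%E.
Proof.
move=> le_C; apply: ge_ereal_sup => e [pi [piD ee]].
by rewrite (expected_payoffE (D_admissible piD) ee); exact: le_C.
Qed.

(** Verification: a solution of the Bellman equation attained by [p] is the
    value, being an upper bound of all payoffs and a lower bound of the payoff
    of the stationary policy [p]. *)
Lemma value_of_solution W p : (forall s, D s (p s)) ->
  (forall s w, D s w -> backup g W s w <= W s) ->
  (forall s, W s <= backup g W s (p s)) ->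
  forall s, value q gamma D g s = (W s)%:E.
Proof.
move=> pD W_ge W_le s; apply/eqP; rewrite eq_le; apply/andP; split.
  apply: value_le => pi piD; rewrite lee_fin.
  apply: (payoff_le q_prob gamma01 (D_admissible piD)) => t s'.
  exact: W_ge.
apply: le_trans (payoff_le_value s (fun=> pD)).
by rewrite lee_fin; exact: (payoff_ge q_prob gamma01 (D_admissible (fun=> pD))).
Qed.

(** Conversely, the value solves the Bellman equation as soon as some [p] is
    greedy for it. The value is at most its backup, by splitting off the first
    stage; so it is a subsolution for the stationary policy [p], whose payoff
    therefore attains it. *)
Lemma value_of_greedy p : (forall s, D s (p s)) ->
  let V s := fine (value q gamma D g s) in
  (forall s w, D s w -> backup g V s w <= backup g V s (p s)) ->
  forall s, V s = backup g V s (p s).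
Proof.
move=> pD V p_greedy.
have pD' : forall (t : nat) s', D s' (p s') by [].
have valueE s : value q gamma D g s = (V s)%:E.
  rewrite /V fineK // fin_numElt; apply/andP; split.
    exact: lt_le_trans (ltNyr _) (payoff_le_value s pD').
  apply: (@le_lt_trans _ _ (M / (1 - gamma))%:E); last exact: ltry.
  apply: value_le => pi piD; rewrite lee_fin (le_trans (ler_norm _)) //.
  exact: (payoff_norm_le q_prob gamma01 _ (D_admissible piD)).
have le_V pi s : (forall t s', D s' (pi t s')) -> payoff g pi s <= V s.
  by move=> piD; rewrite -lee_fin -valueE; exact: payoff_le_value.
have V_le s : V s <= backup g V s (p s).
  rewrite -lee_fin -valueE; apply: value_le => pi piD; rewrite lee_fin.
  rewrite (payoff_recursion q_prob gamma01 _ (D_admissible piD)).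
  apply: le_trans (p_greedy _ _ (piD 0%N s)).
  apply: (backup_le q_prob gamma01) => [|s']; first exact: D_simplex.
  by apply: le_V => t; exact: piD.
have adm := D_admissible pD'.
move=> s; apply/eqP; rewrite eq_le V_le /=.
apply: le_trans (le_V _ s pD'); rewrite (payoff_recursion q_prob gamma01 _ adm).
apply: (backup_le q_prob gamma01) => [|s']; first exact: D_simplex.
exact: (payoff_ge q_prob gamma01 adm).
Qed.

End ValueFunction.

End Value.

(** * Strictly concave functions on the simplex *)

Section StrictlyConcave.
Variables (R : realType) (A : finType).
Implicit Types (w : {ffun A -> R}) (phi : {ffun A -> R} -> R).

Definition vertex (a : A) : {ffun A -> R} := [ffun b => (b == a)%:R].

Lemma vertex_simplex a : simplex R A (vertex a).
Proof.
split=> [b|]; first by rewrite ffunE.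
rewrite (bigD1 a) //= ffunE eqxx big1 ?addr0 // => b /negbTE ba.
by rewrite ffunE ba.
Qed.

Lemma simplex_convex w w' (t : R) : 0 <= t <= 1 ->
  simplex R A w -> simplex R A w' ->
  simplex R A [ffun a => t * w a + (1 - t) * w' a].
Proof.
move=> t01 [w_ge0 w1] [w'_ge0 w'1]; split=> [a|].
  by rewrite ffunE addr_ge0 // mulr_ge0 //; lra.
under eq_bigr do rewrite ffunE.
by rewrite big_split /= -!big_distrr /= w1 w'1; ring.
Qed.

Lemma simplex_le1 w a : simplex R A w -> w a <= 1.
Proof. by move=> [w_ge0 <-]; rewrite (bigD1 a) //= lerDl sumr_ge0. Qed.

Lemma simplex_vertex w a : simplex R A w -> w a = 1 -> w = vertex a.
Proof.
move=> [w_ge0 w1] wa; apply/ffunP => b; rewrite ffunE.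
case: eqP => [->//|/eqP ba]; move: w1; rewrite (bigD1 a) //= wa.
move=> w1; have rest0 : \sum_(i | i != a) w i = 0 by lra.
by apply: (psumr_eq0P _ rest0).
Qed.

(** Jensen's inequality in weak form, by splitting one vertex off at a time:
    each splitting decreases the size of the support. *)
Lemma concave_lower_bound phi : strictly_concave_on (simplex R A) phi ->
  forall w, simplex R A w -> - (\sum_a `|phi (vertex a)|) <= phi w.
Proof.
move=> phiC; set L := \sum_a _.
have vertex_ge a : - L <= phi (vertex a).
  rewrite /L (bigD1 a) //= lerNl (le_trans (ler_norm _)) // normrN lerDl.
  by rewrite sumr_ge0.
move=> w; have [n] := ubnP #|[pred a | w a != 0]|.
elim: n w => // n IHn w supp_w w_prob.
have [a wa] : exists a, w a != 0.
  apply/existsP; apply: contraT => /existsPn w0.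
  have := w_prob.2; rewrite big1 => [/esym/eqP|a _]; first by rewrite oner_eq0.
  by apply/eqP; move: (w0 a); rewrite negbK.
have [wa1|wa1] := eqVneq (w a) 1; first by rewrite (simplex_vertex w_prob wa1).
have wa_gt0 : 0 < w a by rewrite lt_def wa w_prob.1.
have wa_lt1 : w a < 1 by rewrite lt_def eq_sym wa1 simplex_le1.
pose w' : {ffun A -> R} := [ffun b => if b == a then 0 else w b / (1 - w a)].
have w'_prob : simplex R A w'.
  split=> [b|].
    rewrite ffunE; case: ifP => // _; rewrite divr_ge0 ?w_prob.1 //; lra.
  rewrite (bigD1 a) //= ffunE eqxx add0r.
  rewrite (eq_bigr (fun b => w b / (1 - w a))); last first.
    by move=> b /negbTE ba; rewrite ffunE ba.
  rewrite -big_distrl /=; have := w_prob.2; rewrite (bigD1 a) //= => E.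
  have -> : \sum_(i | i != a) w i = 1 - w a by lra.
  by rewrite divff // gt_eqF // subr_gt0.
have wE : w = [ffun b => w a * vertex a b + (1 - w a) * w' b].
  apply/ffunP => b; rewrite !ffunE; case: eqP => [->|_] /=.
    by rewrite mulr0 addr0 mulr1.
  by rewrite mulr0 add0r mulrC divfK // subr_eq0 eq_sym.
have ne : vertex a <> w'.
  by move/ffunP/(_ a); rewrite !ffunE eqxx => /eqP; rewrite oner_eq0.
have := phiC _ _ (w a) (vertex_simplex a) w'_prob ne.
rewrite -wE wa_gt0 wa_lt1 => /(_ isT).
have w'_ge : - L <= phi w'.
  apply: IHn w'_prob; rewrite -ltnS; apply: leq_trans supp_w; rewrite ltnS.
  apply: proper_card; apply/properP; split; last first.
    by exists a; rewrite !inE // ffunE !eqxx.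
  apply/fintype.subsetP => b; rewrite !inE ffunE.
  case: (b =P a) => _; first by rewrite eqxx.
  by rewrite mulf_eq0 negb_or => /andP[].
have v_part : 0 <= w a * (phi (vertex a) + L).
  by rewrite mulr_ge0 ?(ltW wa_gt0) //; have := vertex_ge a; lra.
have w'_part : 0 <= (1 - w a) * (phi w' + L) by rewrite mulr_ge0 //; lra.
lra.
Qed.

(** A large value at [w] would force, through the barycentre [u] of the simplex
    and a point [w'] beyond it on the line from [w], a large value at [u]. The
    weight [t] of [w] is half of the largest weight that keeps [w'] in the
    simplex for all [w], so that [t < 1] even for a single action. *)
Lemma concave_bounded phi : strictly_concave_on (simplex R A) phi ->
  exists M, forall w, simplex R A w -> `|phi w| <= M.
Proof.
move=> phiC; have := concave_lower_bound phiC.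
set L := \sum_a _ => ge_L.
have L_ge0 : 0 <= L by rewrite sumr_ge0.
have [A0|A_gt0] := posnP #|A|.
  exists 0 => w [_]; rewrite big1 => [/esym/eqP|a _]; first by rewrite oner_eq0.
  by have := card0_eq A0 a; rewrite inE.
pose N : R := #|A|%:R.
have N_ge1 : 1 <= N by rewrite ler1n.
pose u : {ffun A -> R} := [ffun=> N^-1].
have u_prob : simplex R A u.
  split=> [a|]; first by rewrite ffunE invr_ge0; lra.
  under eq_bigr do rewrite ffunE.
  by rewrite sumr_const -mulr_natr mulVf // gt_eqF //; lra.
pose t : R := (N *+ 2)^-1.
have tN : t * N *+ 2 = 1 by rewrite /t; field; lra.
have t_gt0 : 0 < t by rewrite /t invr_gt0; lra.
have t_lt1 : t < 1 by nra.
have N_inv : N^-1 = t *+ 2 by rewrite /t; field; lra.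
exists (`|phi u| + (`|phi u| + L) / t + L) => w w_prob.
have ge_w := ge_L w w_prob.
suff w_le : phi w <= `|phi u| + (`|phi u| + L) / t.
  have : 0 <= `|phi u| + (`|phi u| + L) / t.
    by rewrite addr_ge0 // divr_ge0 ?addr_ge0 // ltW.
  by move=> ?; rewrite ler_norml; lra.
have [->|/eqP wu] := eqVneq w u.
  by rewrite (le_trans (ler_norm _)) // lerDl divr_ge0 ?addr_ge0 // ltW.
pose w' : {ffun A -> R} := [ffun a => (u a - t * w a) / (1 - t)].
have w'_prob : simplex R A w'.
  split=> [a|].
    rewrite ffunE divr_ge0 //; last by lra.
    rewrite ffunE N_inv; have := simplex_le1 a w_prob; have := w_prob.1 a.
    nra.
  under eq_bigr do rewrite ffunE.
  rewrite -big_distrl /= sumrB -big_distrr /= u_prob.2 w_prob.2 mulr1.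
  by rewrite divff // gt_eqF // subr_gt0.
have uE : u = [ffun a => t * w a + (1 - t) * w' a].
  apply/ffunP => a; rewrite [in RHS]ffunE [w' a]ffunE; field; lra.
have ne : w <> w'.
  move=> ww'; apply: wu; rewrite uE -ww'; apply/ffunP => a; rewrite ffunE; ring.
have := phiC _ _ t w_prob w'_prob ne; rewrite t_gt0 t_lt1 => /(_ isT).
rewrite -uE => u_gt; have := ge_L w' w'_prob => ge_w'.
have : phi w <= (`|phi u| + L) / t.
  by rewrite ler_pdivlMr //; have := ler_norm (phi u); nra.
by move=> le_w; rewrite (le_trans le_w) // lerDr.
Qed.

(** The midpoint of two distinct maximizers would do strictly better. *)
Lemma argmax_unique (h : A -> R) phi w w' :
  strictly_concave_on (simplex R A) phi ->
  is_argmax (simplex R A) (fun v => \sum_a v a * h a + phi v) w ->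
  simplex R A w' ->
  \sum_a w a * h a + phi w <= \sum_a w' a * h a + phi w' -> w' = w.
Proof.
move=> phiC [w_prob w_max] w'_prob w'_ge; apply: contrapT => ne.
have half : 0 < (2^-1 : R) < 1 by lra.
have mid := phiC _ _ _ w'_prob w_prob ne half.
have half' : 0 <= (2^-1 : R) <= 1 by lra.
have := w_max _ (simplex_convex half' w'_prob w_prob).
rewrite (_ : \sum_a _ = 2^-1 * (\sum_a w' a * h a) + 2^-1 * (\sum_a w a * h a)).
  lra.
rewrite !big_distrr -big_split /=; apply: eq_bigr => a _; rewrite ffunE /=; lra.
Qed.

End StrictlyConcave.

Theorem proposition4 (R : realType) (S A : finType)
    (q : S -> A -> {ffun S -> R}) (r : S -> A -> R) (gamma : R)
    (phi : S -> {ffun A -> R} -> R)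
    (A_nonempty : (0 < #|A|)%N)
    (q_prob : forall s a, simplex R S (q s a))
    (gamma01 : 0 <= gamma < 1)
    (phi_concave : forall s, strictly_concave_on (simplex R A) (phi s)) :
  exists c : S -> R,
    let r' : S -> A -> R := fun s a => r s a - c s in
    let D : S -> set {ffun A -> R} :=
      fun s => [set p | simplex R A p /\ - phi s p <= c s] in
    (forall s, D s !=set0) /\
    (forall pi_opt : policy R S A, rmdp_optimal q gamma r phi pi_opt ->
       forall pi : policy R S A,
         ctmdp_optimal q gamma r' D pi <-> pi = pi_opt).
Proof.
have [[ps ps_opt]|none] := pselect (exists p, rmdp_optimal q gamma r phi p);
    last first.
  (* Without an optimal policy the constants need only make the sets [D s]
     nonempty. *)
  case/card_gt0P: (A_nonempty) => a0 _.
  exists (fun s => - phi s (vertex R a0)); split=> [s|p p_opt].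
    by exists (vertex R a0); split; [exact: vertex_simplex | rewrite lexx].
  by case: none; exists p.
have ps_prob s : simplex R A (ps s) := (ps_opt s).1.
pose c s := - phi s (ps s); exists c => r' D.
pose V s := fine (rmdp_value q gamma r phi s).
pose Q := action_value q gamma r (rmdp_value q gamma r phi).
have psD s : D s (ps s) by split; [exact: ps_prob | rewrite lexx].
have [M phiM] : exists M, forall s w, simplex R A w -> `|phi s w| <= M.
  have /choice[B phiB] :
      forall s, exists B, forall w, simplex R A w -> `|phi s w| <= B.
    by move=> s; exact: concave_bounded.
  exists (\sum_s `|B s|) => s w /phiB/le_trans; apply.
  by rewrite (bigD1 s) //= (le_trans (ler_norm _)) // lerDl sumr_ge0.
have [rM r_le] : exists rM, forall s a, `|r s a| <= rM.
  exists (\sum_s \sum_a `|r s a|) => s a.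
  by rewrite (bigD1 s) //= (bigD1 a) //= -addrA lerDl;
    rewrite addr_ge0 ?sumr_ge0 // => ? _; rewrite sumr_ge0.
have c_le s : `|c s| <= M by rewrite normrN phiM.
pose g s a w := r s a + phi s w.
have backup_r s w : simplex R A w ->
    backup q gamma g V s w = \sum_a w a * Q s a + phi s w.
  move=> w_prob; rewrite -[phi s w in RHS](mean_cst _ w_prob) -big_split /=.
  by apply: eq_bigr => a _; rewrite -mulrDr /g addrAC.
pose g' s a (_ : {ffun A -> R}) := r' s a.
have backup_c s w : simplex R A w ->
    backup q gamma g' V s w = \sum_a w a * Q s a - c s.
  move=> w_prob; rewrite -[- c s](mean_cst _ w_prob) -big_split /=.
  by apply: eq_bigr => a _; rewrite -mulrDr /g' /r' addrAC.
(* The Bellman equation of the regularized problem, attained at [ps]. *)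
have VE s : V s = \sum_a ps s a * Q s a + phi s (ps s).
  rewrite -backup_r //.
  apply: (@value_of_greedy R S A q gamma q_prob gamma01 (fun=> simplex R A) g
    (rM + M) A_nonempty (fun=> @subset_refl _ _)) => // [s' a w w_prob|s' w w_prob].
    by rewrite (le_trans (ler_normD _ _)) // lerD // phiM.
  by rewrite -/V !backup_r //; exact: (ps_opt s').2.
(* The same [V] solves the constrained Bellman equation: on [D s] the constant
   [- c s] is at most the regularizer, with equality at [ps s]. *)
have ctmdp_V s : ctmdp_value q gamma r' D s = (V s)%:E.
  apply: (@value_of_solution R S A q gamma q_prob gamma01 D g' (rM + M)
    A_nonempty _ _ V ps) => // [s' w [] //|s' a w _|s' w [w_prob w_D]|s'].
  - by rewrite (le_trans (ler_normB _ _)) // lerD.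
  - rewrite backup_c // VE; have := (ps_opt s').2 w w_prob; rewrite -/Q.
    by move: w_D; lra.
  - by rewrite backup_c // VE opprK.
have Q'E s a :
    action_value q gamma r' (ctmdp_value q gamma r' D) s a = Q s a - c s.
  rewrite /Q /action_value /r' addrAC; congr (_ + _ * _ + _).
  by apply: eq_bigr => s' _; rewrite ctmdp_V.
have mean_Q' s w : simplex R A w ->
    \sum_a w a * action_value q gamma r' (ctmdp_value q gamma r' D) s a
    = \sum_a w a * Q s a - c s.
  move=> w_prob; rewrite -[- c s](mean_cst _ w_prob) -big_split /=.
  by apply: eq_bigr => a _; rewrite Q'E mulrDr.
have ctmdpP p : ctmdp_optimal q gamma r' D p <-> p = ps.
  split=> [p_opt|->].
    (* On [D s] a constrained maximizer does at least as well as [ps s] for the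
       regularized objective, which has a single maximizer. *)
    apply/funext => s; have [[p_prob p_D] p_max] := p_opt s.
    apply: (argmax_unique (phi_concave s) (ps_opt s) p_prob); rewrite -/Q.
    have := p_max _ (psD s); rewrite !mean_Q' //.
    by move: p_D; rewrite /c; lra.
  move=> s; split=> // w [w_prob w_D]; rewrite !mean_Q' //.
  have := (ps_opt s).2 w w_prob; rewrite -/Q; move: w_D; rewrite /c; lra.
split=> [s|po po_opt p]; first by exists (ps s).
rewrite ctmdpP (_ : po = ps) //; apply/funext => s.
apply: (argmax_unique (phi_concave s) (ps_opt s) (po_opt s).1).
exact: (po_opt s).2.
Qed.
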